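(* Let $n$ be a positive integer and $r,k$ integers. Suppose $(n,k)=1$, $r>1$, and $r\equiv 1\bmod n$. Then $F(r,n,k)$ is the metacyclic group \[B\left((r^n-1)/n,\ n,\ r^{(n-1)\bar{A}},\ 1\right)\] of order $r^n-1$, where $(r+k-1)\bar{A}\equiv 1\bmod n$.
   Context: $(a,b)$ denotes the greatest common divisor. For a word $w$ in $x_0,\dots,x_{n-1}$, $G_n(w)=\langle x_0,\dots,x_{n-1}\mid w,\theta(w),\dots,\theta^{n-1}(w)\rangle$ where $\theta(x_i)=x_{i+1}$, subscripts modulo $n$. For $r,s>0$, $P(r,n,l,s,f)=G_n\big((x_0x_f\cdots x_{(r-1)f})(x_{(l-1)}x_{(l-1)+f}\cdots x_{(l-1)+(s-1)f})^{-1}\big)$, and $F(r,n,k)=P(r,n,r+k,1,1)$, i.e. $F(r,n,k)=G_n\big((x_0x_1\cdots x_{r-1})x_{r+k-1}^{-1}\big)$. For integers $M,N,R,\lambda$ with $R^N\equiv 1\bmod M$, $B(M,N,R,\lambda)=\langle a,b\mid a^M=1,\ bab^{-1}=a^R,\ b^N=a^{\lambda M/(M,R-1)}\rangle$. The parameter $R$ matters only modulo $M$; powers of $r$ with possibly negative exponents are read modulo $r^n-1$. A group is metacyclic if it has a cyclic normal subgroup with cyclic quotient. *)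

(* Defs.v *)
From HB Require Import structures.
From mathcomp Require Import all_boot all_order all_algebra.
From mathcomp Require Import boolp classical_sets functions cardinality.

Set Implicit Arguments.
Unset Strict Implicit.
Unset Printing Implicit Defensive.

Import Order.TTheory GRing.Theory Num.Theory.

(* The letter (x, false) stands for the generator x, and (x, true) for x^-1. *)
Definition word (X : Type) := seq (X * bool).

Definition winv X (w : word X) : word X := rev [seq (l.1, ~~ l.2) | l <- w].

Definition wpow X (w : word X) (z : int) : word X :=
  match z with
  | Posz m => flatten (nseq m w)
  | Negz m => flatten (nseq m.+1 (winv w))
  end.

(* The least congruence on words that cancels mutually inverse adjacent letters
   and kills the relators: u and v are related iff they represent the same
   element of < X | rels >. *)
Inductive word_cong (X : eqType) (rels : seq (word X)) : word X -> word X -> Prop :=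
| WordCancel x b : word_cong rels [:: (x, b); (x, ~~ b)] [::]
| WordRelator u of u \in rels : word_cong rels u [::]
| WordCat u u' v v' of word_cong rels u u' & word_cong rels v v' :
    word_cong rels (u ++ v) (u' ++ v')
| WordRefl u : word_cong rels u u
| WordSym u v of word_cong rels u v : word_cong rels v u
| WordTrans u v w of word_cong rels u v & word_cong rels v w : word_cong rels u w.

Section Presentation.
Variables (X : choiceType) (rels : seq (word X)).

Definition word_congb : rel (seq (X * bool)) := fun u v => `[< word_cong rels u v >].

Lemma word_congb_refl : reflexive word_congb.
Proof. by move=> u; apply/asboolP; exact: WordRefl. Qed.

Lemma word_congb_sym : symmetric word_congb.
Proof. by move=> u v; apply/asboolP/asboolP; exact: WordSym. Qed.

Lemma word_congb_trans : transitive word_congb.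
Proof.
by move=> v u w /asboolP uv /asboolP vw; apply/asboolP; exact: WordTrans uv vw.
Qed.

Canonical word_congb_equiv :=
  EquivRel word_congb word_congb_refl word_congb_sym word_congb_trans.

(* The group < X | rels >. *)
Definition presented := {eq_quot word_congb}%qT.

HB.instance Definition _ := Choice.on presented.

Definition pres_class (w : word X) : presented := \pi_({eq_quot word_congb})%qT w.

Lemma pres_classP u v : pres_class u = pres_class v <-> word_cong rels u v.
Proof.
split=> [/eqmodP/asboolP //|uv]; by apply/eqmodP/asboolP.
Qed.

Lemma pres_classK (a : presented) : pres_class (repr a) = a.
Proof. exact: reprK. Qed.

Lemma repr_class u : word_cong rels (repr (pres_class u)) u.
Proof. by apply/pres_classP; rewrite pres_classK. Qed.

Lemma winv_cat (u v : word X) : winv (u ++ v) = winv v ++ winv u.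
Proof. by rewrite /winv map_cat rev_cat. Qed.

Lemma winvK (w : word X) : winv (winv w) = w.
Proof.
rewrite /winv map_rev revK -map_comp map_id_in // => -[x b] _ /=.
by rewrite negbK.
Qed.

Lemma word_mulV (w : word X) : word_cong rels (w ++ winv w) [::].
Proof.
elim: w => [|[x b] w IHw]; first exact: WordRefl.
rewrite -cat1s winv_cat -catA (catA w).
apply: WordTrans (WordCancel rels x b).
apply: (WordCat (WordRefl _ [:: (x, b)])).
exact: (WordCat IHw (WordRefl _ [:: (x, ~~ b)])).
Qed.

Lemma word_Vmul (w : word X) : word_cong rels (winv w ++ w) [::].
Proof. by rewrite -{2}[w]winvK; exact: word_mulV. Qed.

Lemma winv_cong u v : word_cong rels u v -> word_cong rels (winv u) (winv v).
Proof.
move=> uv; rewrite -[winv u]cats0 -[winv v]cat0s.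
apply: WordTrans (WordCat (word_Vmul u) (WordRefl _ _)).
rewrite -catA; apply: WordCat (WordRefl _ _) _.
apply: WordTrans (WordSym (word_mulV v)) _.
exact: WordCat (WordSym uv) (WordRefl _ _).
Qed.

Definition pres_one := pres_class [::].
Definition pres_mul (a b : presented) := pres_class (repr a ++ repr b).
Definition pres_inv (a : presented) := pres_class (winv (repr a)).

Lemma pres_mulE u v : pres_mul (pres_class u) (pres_class v) = pres_class (u ++ v).
Proof. by apply/pres_classP; apply: WordCat; exact: repr_class. Qed.

Lemma pres_invE u : pres_inv (pres_class u) = pres_class (winv u).
Proof. by apply/pres_classP; apply/winv_cong/repr_class. Qed.

Lemma pres_mulA : associative pres_mul.
Proof.
move=> a b c; rewrite -[a]pres_classK -[b]pres_classK -[c]pres_classK.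
by rewrite !pres_mulE catA.
Qed.

Lemma pres_mul1g : left_id pres_one pres_mul.
Proof. by move=> a; rewrite -[a]pres_classK pres_mulE. Qed.

Lemma pres_mulg1 : right_id pres_one pres_mul.
Proof. by move=> a; rewrite -[a]pres_classK pres_mulE cats0. Qed.

Lemma pres_mulVg : left_inverse pres_one pres_inv pres_mul.
Proof.
by move=> a; rewrite -[a]pres_classK pres_invE pres_mulE; apply/pres_classP/word_Vmul.
Qed.

Lemma pres_mulgV : right_inverse pres_one pres_inv pres_mul.
Proof.
by move=> a; rewrite -[a]pres_classK pres_invE pres_mulE; apply/pres_classP/word_mulV.
Qed.

HB.instance Definition _ := isGroup.Build presented
  pres_mulA pres_mul1g pres_mulg1 pres_mulVg pres_mulgV.

End Presentation.

Definition group_iso (G H : groupType) : Prop :=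
  exists f : {multiplicative G -> H}, bijective f.

Section Metacyclic.
Variable G : groupType.
Local Open Scope classical_set_scope.
Local Open Scope group_scope.

Definition expgz (x : G) (z : int) : G :=
  match z with Posz m => x ^+ m | Negz m => x ^- m.+1 end.

Definition is_subgroup (N : set G) : Prop :=
  [/\ N 1, (forall x y, N x -> N y -> N (x * y)) & (forall x, N x -> N x^-1)].

Definition is_normal_subgroup (N : set G) : Prop :=
  is_subgroup N /\ (forall x g, N x -> N (g * x * g^-1)).

Definition is_cyclic (N : set G) : Prop := exists a, N = range (expgz a).

(* G / N is generated by the coset b N: every coset g N equals b^z N for some z. *)
Definition cyclic_quotient (N : set G) : Prop :=
  exists b, forall g, exists z, N ((expgz b z)^-1 * g).

Definition metacyclic_group : Prop :=
  exists N : set G, [/\ is_normal_subgroup N, is_cyclic N & cyclic_quotient N].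

End Metacyclic.

Section CyclicPresentation.
Variable n : nat.

(* The substitution x_i |-> x_(i+1), subscripts modulo n. *)
Definition theta (w : word 'I_n) : word 'I_n := [seq (ordS l.1, l.2) | l <- w].

Definition cyc_presented (w : word 'I_n) := presented (traject theta w n).

End CyclicPresentation.

(* The word x_i x_(i+f) ... x_(i+(m-1)f), integer subscripts reduced modulo n.
   For n > 0 the index type 'I_n.-1.+1 is 'I_n, in the form inord requires. *)
Definition step_word (n m : nat) (i f : int) : word 'I_n.-1.+1 :=
  [seq (inord `|((i + j%:Z * f)%R %% n%:Z)%Z|%N, false) | j <- iota 0 m].

(* P(r, n, l, s, f), for n, r, s > 0. *)
Definition P_group (r n : nat) (l : int) (s : nat) (f : int) :=
  cyc_presented (step_word n r 0 f ++ winv (step_word n s (l - 1)%R f)).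

Definition F_group (r n : nat) (k : int) := P_group r n (r%:Z + k)%R 1 1.

(* B(M, N, R, lam) = < a, b | a^M, b a b^-1 a^(-R), b^N a^(- lam M / (M, R-1)) >. *)
Definition B_group (M N R lam : int) :=
  let a : word 'I_2 := [:: (ord0, false)] in
  let b : word 'I_2 := [:: (ord_max, false)] in
  presented
    [:: wpow a M;
        b ++ a ++ winv b ++ winv (wpow a R);
        wpow b N ++ winv (wpow a (lam * M %/ gcdz M (R - 1)%R)%Z) ].

(* R is a value of r^e modulo m; for e < 0 this says that R is an inverse of
   r^(-e) modulo m. *)
Definition is_powmod (m r e R : int) : Prop :=
  match e with
  | Posz d => (R = (r ^+ d)%R %[mod m])%Z
  | Negz d => ((R * r ^+ d.+1)%R = 1%R %[mod m])%Z
  end.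

(* Main.v *)
Require Import Defs.
From HB Require Import structures.
From mathcomp Require Import all_boot all_order all_algebra.
From mathcomp Require Import boolp classical_sets functions cardinality.
From mathcomp Require Import zify ring.

(** Why the theorem holds.  Write [r = 1 + n q], let [alpha] and [kappa] be
    residues of [A] and [r + k - 1], so that they are inverse to each other
    modulo [n], and put [rho = r ^ alpha], [n s = 1 + r + ... + r^(n-1)] and
    [M = (r - 1) s], so that [n M = r^n - 1].

    Read the generators of [F(r,n,k)] as an [n]-periodic sequence [y] and let
    [P_i = y_i y_(i+1) ... y_(i+n-1)].  By periodicity the defining relation is
    [y_(i+kappa) = P_i^q y_i], while [P_i y_i = y_i P_(i+1)] holds in any group.
    Multiplying [n] consecutive relations and moving all the factors [P_j^q] to
    the left gives [P_(i+kappa) = P_i^(nq) P_i = P_i^r]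
    ([window_kappa]).  Since [kappa] is invertible modulo [n], every [P_i] is a
    power of [a = P_0], and with [b = y_0] every [y_i] is an explicit element
    [b a^e] ([cyc_normal]).  The relation [P_0 y_0 = y_0 P_1] is
    [a b = b a^rho], going once around the cycle gives [a^M = 1], and expanding
    [a = P_0] in terms of the [b a^e] gives [b^n = a^s] ([cyc_rel_meta]).
    Conversely, in any group where these three relations hold, the elements
    [b a^e] satisfy the relations of [F(r,n,k)] ([cyc_elt_rel]).

    The three relations also define the metacyclic group of the statement:
    [R] is the inverse of [rho] modulo [M], and [gcd(M, R - 1) = r - 1], so that
    [M / gcd(M, R - 1) = s] ([B_relatorsP], [quotient_gcd]).

    They make every element equal to some [b^i a^x] with [0 <= i < n] and [x]
    modulo [M], hence bound the order by [n M].  The bound is attained: the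
    affine maps [x |-> x + n] and [x |-> rho x + 1] of the integers modulo [n M]
    satisfy the relations and generate a regular permutation group, so this
    group lives on the residues modulo [n M] themselves ([affine_group]).  Both
    presented groups map bijectively to it ([meta_model_bijective]). *)

Set Implicit Arguments.
Unset Strict Implicit.
Unset Printing Implicit Defensive.

Import Order.TTheory GRing.Theory Num.Theory.

(** * Morphisms out of a presented group *)

Section WordEvaluation.
Variables (X : choiceType) (G : groupType) (f : X -> G).
Local Open Scope group_scope.

Definition letter_eval (l : X * bool) : G := if l.2 then (f l.1)^-1 else f l.1.

Definition word_eval (w : word X) : G := \prod_(l <- w) letter_eval l.

Lemma word_eval_cat u v : word_eval (u ++ v) = word_eval u * word_eval v.
Proof. exact: big_cat. Qed.

Lemma word_eval1 x : word_eval [:: (x, false)] = f x.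
Proof. exact: big_seq1. Qed.

Lemma word_eval_winv w : word_eval (winv w) = (word_eval w)^-1.
Proof.
elim: w => [|[x b] w IHw]; first by rewrite /word_eval /winv !big_nil invg1.
rewrite -cat1s winv_cat !word_eval_cat invgM IHw; congr (_ * _).
by rewrite /word_eval !big_seq1 /letter_eval /=; case: b; rewrite //= invgK.
Qed.

Lemma word_eval_nseq w m : word_eval (flatten (nseq m w)) = word_eval w ^+ m.
Proof.
elim: m => [|m IHm] /=; first by rewrite /word_eval big_nil.
by rewrite word_eval_cat IHm expgS.
Qed.

Lemma word_eval_wpow w z : word_eval (wpow w z) = expgz (word_eval w) z.
Proof.
case: z => m; rewrite /wpow /expgz word_eval_nseq //.
by rewrite word_eval_winv expVgn.
Qed.

Lemma word_eval_cong rels u v :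
  {in rels, forall w, word_eval w = 1} ->
  word_cong rels u v -> word_eval u = word_eval v.
Proof.
move=> rels1; elim=> {u v} [x b|u /rels1->|u u' v v' _ IHu _ IHv|//|//|u v w _ -> _ ->//].
- by rewrite /word_eval big_cons big_seq1 big_nil /letter_eval /=; case: b => /=;
    rewrite ?mulVg ?mulgV.
- by rewrite /word_eval big_nil.
- by rewrite !word_eval_cat IHu IHv.
Qed.

(** The universal property of a presentation: an assignment of the generators
    that satisfies the relators extends to a morphism. *)
Lemma presented_lift rels :
  {in rels, forall w, word_eval w = 1} ->
  exists phi : UMagmaMorphism.type (presented rels) G,
    forall w, phi (pres_class rels w) = word_eval w.
Proof.
move=> rels1; pose phi (g : presented rels) := word_eval (repr g).
have phiE w : phi (pres_class rels w) = word_eval w.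
  exact: word_eval_cong rels1 (repr_class rels w).
have phiM : {morph phi : g h / g * h}.
  by move=> g h; rewrite -[g * h]/(pres_class rels _) phiE word_eval_cat.
have phi1 : phi 1 = 1 by rewrite -[1]/(pres_class rels [::]) phiE /word_eval big_nil.
pose m := isUMagmaMorphism.Build (presented rels) G phi (phi1, phiM).
by exists (HB.pack_for (UMagmaMorphism.type (presented rels) G) phi m) => w; exact: phiE.
Qed.

End WordEvaluation.

Section PresentedGroup.
Variables (X : choiceType) (rels : seq (word X)).
Local Open Scope group_scope.

Let gen x : presented rels := pres_class rels [:: (x, false)].

Lemma pres_class_eval w : pres_class rels w = word_eval gen w.
Proof.
elim: w => [|[x b] w IHw]; first by rewrite /word_eval big_nil.
rewrite -cat1s word_eval_cat -IHw -[LHS]pres_mulE; congr (_ * _).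
case: b; last by rewrite word_eval1.
by rewrite /word_eval big_seq1 /letter_eval /= -[RHS]/(pres_inv _) pres_invE.
Qed.

Lemma relator_eval w : w \in rels -> word_eval gen w = 1.
Proof. by move=> relw; rewrite -pres_class_eval; apply/pres_classP/WordRelator. Qed.

Lemma presented_ind (P : presented rels -> Prop) :
  P 1 -> (forall g h, P g -> P h -> P (g * h)) -> (forall g, P g -> P g^-1) ->
  (forall x, P (gen x)) -> forall g, P g.
Proof.
move=> P1 PM PV Pgen g; rewrite -[g]pres_classK pres_class_eval.
by apply: big_rec => // -[x []] h _ Ph; apply: PM => //; [apply: PV|]; apply: Pgen.
Qed.

End PresentedGroup.

(** * Powers and geometric sums modulo an integer *)

Lemma expn_mod_period b n m i j :
  b ^ n = 1 %[mod m] -> i = j %[mod n] -> b ^ i = b ^ j %[mod m].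
Proof.
move=> bn; have red k : b ^ k = b ^ (k %% n) %[mod m].
  rewrite {1}(divn_eq k n) expnD [k %/ n * n]mulnC expnM.
  by rewrite -modnMml -modnXm bn modnXm exp1n modnMml mul1n.
by move=> ij; rewrite red ij -red.
Qed.

Lemma expg_mod_period (G : groupType) (x : G) n i j :
  (x ^+ n = 1)%g -> i = j %[mod n] -> (x ^+ i = x ^+ j)%g.
Proof.
move=> xn; have red k : (x ^+ k = x ^+ (k %% n))%g.
  by rewrite {1}(divn_eq k n) expgnDr [k %/ n * n]mulnC expgnA xn expg1n mul1g.
by move=> ij; rewrite red ij -red.
Qed.

(** The [b]-analogue of the integer [m]: in the groups below, the exponents
    produced by repeated conjugation are sums of this form. *)
Definition gsum (b m : nat) := \sum_(i < m) b ^ i.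

Lemma gsumS b m : gsum b m.+1 = gsum b m + b ^ m.
Proof. exact: big_ord_recr. Qed.

Lemma gsumSl b m : gsum b m.+1 = 1 + b * gsum b m.
Proof.
rewrite /gsum big_ord_recl big_distrr; congr (_ + _).
by apply: eq_bigr => i _ /=; rewrite -expnS.
Qed.

Lemma gsumD b i j : gsum b (i + j) = gsum b i + b ^ i * gsum b j.
Proof.
elim: j => [|j IHj]; first by rewrite addn0 /gsum big_ord0 muln0 addn0.
by rewrite addnS !gsumS IHj expnD mulnDr addnA.
Qed.

Lemma gsum_telescope b m : 0 < b -> b.-1 * gsum b m + 1 = b ^ m.
Proof. by move=> b0; rewrite /gsum -predn_exp addn1 prednK ?expn_gt0 ?b0. Qed.

Lemma gsum_mod b n m : b = 1 %[mod n] -> gsum b m = m %[mod n].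
Proof.
move=> b1; elim: m => [|m IHm]; first by rewrite /gsum big_ord0.
by rewrite gsumS -modnDm IHm -modnXm b1 modnXm exp1n modnDm addn1.
Qed.

(** * A regular group of affine maps modulo n M *)

Section AffineModel.
Variables n M rho : nat.

(** [rho = 1] modulo [n] makes an orbit of [x |-> rho x + 1] meet every class
    modulo [n]; [rho ^ n = 1] modulo [n M] makes [rho ^ x] depend only on [x]
    modulo [n]. *)
Definition affine_params :=
  [&& 0 < n, 0 < M, rho == 1 %[mod n] & rho ^ n == 1 %[mod n * M]].

(** The residue [x] stands for the map [z |-> rho ^ x * z + x], which is the
    unique element of the group generated by [z |-> z + n] and
    [z |-> rho * z + 1] that sends [0] to [x].  Storing only the image of [0]
    makes the order of the group evident. *)
Definition affine_group (_ : affine_params) : Type := 'I_(n * M).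

Section Group.
Hypothesis h : affine_params.
Let K := affine_group h.

HB.instance Definition _ := Choice.on K.

Let n_gt0 : 0 < n. Proof. by case/and4P: h. Qed.
Let M_gt0 : 0 < M. Proof. by case/and4P: h. Qed.
Let rho1 : rho = 1 %[mod n]. Proof. by case/and4P: h => _ _ /eqP. Qed.
Let rhon : rho ^ n = 1 %[mod n * M]. Proof. by case/and4P: h => _ _ _ /eqP. Qed.
Let N_gt0 : 0 < n * M. Proof. by rewrite muln_gt0 n_gt0. Qed.

Definition affine_elt (x : nat) : K := Ordinal (ltn_pmod x N_gt0).
Definition affine_val (x : K) : nat := nat_of_ord (x : 'I_(n * M)).

(** Maps act on the right: the image of [0] under [x] is moved by [y]. *)
Definition affine_mul (x y : K) : K :=
  affine_elt (rho ^ affine_val y * affine_val x + affine_val y).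
Definition affine_inv (x : K) : K :=
  affine_elt (rho ^ (n.-1 * affine_val x) * ((n * M).-1 * affine_val x)).

Lemma affine_eltP x y : affine_elt x = affine_elt y <-> x = y %[mod n * M].
Proof. by split=> [/(congr1 affine_val)|e] //; apply: ord_inj. Qed.

Lemma affine_valK x : affine_elt (affine_val x) = x.
Proof. by apply: ord_inj; rewrite /= modn_small ?ltn_ord. Qed.

Lemma affine_eltK x : affine_val (affine_elt x) = x %% (n * M).
Proof. by []. Qed.

Lemma affine_mulE x y :
  affine_mul (affine_elt x) (affine_elt y) = affine_elt (rho ^ y * x + y).
Proof.
apply/affine_eltP; rewrite !affine_eltK -modnDm modn_mod -modnMm modn_mod.
rewrite (_ : rho ^ _ = rho ^ y %[mod n * M]) ?modnMm ?modnDm //.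
by apply: expn_mod_period rhon _; rewrite modn_dvdm // dvdn_mulr.
Qed.

Let affine_invE x :
  affine_inv (affine_elt x) = affine_elt (rho ^ (n.-1 * x) * ((n * M).-1 * x)).
Proof.
apply/affine_eltP; rewrite !affine_eltK mulnA -modnMmr modn_mod modnMmr -mulnA.
rewrite -[LHS]modnMml -[RHS]modnMml; congr (_ * _ %% _).
by apply: expn_mod_period rhon _; rewrite -modnMmr modn_dvdm ?dvdn_mulr ?modnMmr.
Qed.

Let affine_ind (P : K -> Prop) : (forall x, P (affine_elt x)) -> forall x, P x.
Proof. by move=> Pelt x; rewrite -[x]affine_valK. Qed.

(** Associativity amounts to [rho ^ (rho ^ z * y + z) = rho ^ (y + z)], which
    holds because [rho = 1] modulo [n] and exponents matter only modulo [n]. *)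
Let affine_mulA : associative affine_mul.
Proof.
elim/affine_ind=> x; elim/affine_ind=> y; elim/affine_ind=> z.
rewrite !affine_mulE; apply/affine_eltP.
rewrite (_ : rho ^ z * (rho ^ y * x + y) + z = rho ^ (y + z) * x + (rho ^ z * y + z)).
  rewrite -[LHS]modnDml -[RHS]modnDml -[in LHS]modnMml -[in RHS]modnMml.
  congr ((_ * _ %% _ + _) %% _); apply: expn_mod_period rhon _.
  by rewrite -[in LHS]modnDml -modnMml -modnXm rho1 modnXm exp1n modnMml mul1n modnDml.
rewrite expnD; ring.
Qed.

Let affine_mul1 : left_id (affine_elt 0) affine_mul.
Proof. by elim/affine_ind=> x; rewrite affine_mulE muln0. Qed.

Let affine_mulr1 : right_id (affine_elt 0) affine_mul.
Proof. by elim/affine_ind=> x; rewrite affine_mulE mul1n addn0. Qed.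

Let affine_mulV : left_inverse (affine_elt 0) affine_inv affine_mul.
Proof.
elim/affine_ind=> x; rewrite affine_invE affine_mulE; apply/affine_eltP.
rewrite mulnA -expnD -mulSn prednK // -modnDml -modnMml.
rewrite (@expn_mod_period _ n _ _ 0) ?modnMr ?mod0n //.
by rewrite modnMml mul1n modnDml addnC -mulSn prednK // modnMr.
Qed.

Let affine_mulrV : right_inverse (affine_elt 0) affine_inv affine_mul.
Proof.
move=> x; rewrite -[LHS]affine_mul1 -{1}(affine_mulV (affine_inv x)).
by rewrite -affine_mulA (affine_mulA _ x) affine_mulV affine_mul1 affine_mulV.
Qed.

HB.instance Definition _ := isGroup.Build K
  affine_mulA affine_mul1 affine_mulr1 affine_mulV affine_mulrV.

Local Open Scope group_scope.

Lemma affine_eltM x y : affine_elt x * affine_elt y = affine_elt (rho ^ y * x + y)%N.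
Proof. exact: affine_mulE. Qed.

Lemma affine_elt1 : affine_elt 0 = 1. Proof. by []. Qed.

Lemma affine_translation x y : affine_elt x * affine_elt (n * y) = affine_elt (x + n * y)%N.
Proof.
rewrite affine_eltM; apply/affine_eltP.
rewrite -modnDml -modnMml (@expn_mod_period _ n _ _ 0) ?modnMr ?mod0n //.
by rewrite modnMml mul1n modnDml.
Qed.

Lemma affine_expX x : affine_elt n ^+ x = affine_elt (n * x)%N.
Proof.
elim: x => [|x IHx]; first by rewrite muln0.
by rewrite expgSr IHx -[n in X in _ * X]muln1 affine_translation -mulnDr addn1.
Qed.

Lemma affine_exp1 i : affine_elt 1 ^+ i = affine_elt (gsum rho i).
Proof.
elim: i => [|i IHi]; first by rewrite /gsum big_ord0.
by rewrite expgSr IHi affine_eltM expn1 gsumSl addnC.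
Qed.

End Group.
End AffineModel.

(** * The relations a^M = 1, a b = b a^rho, b^n = a^s *)

Section Commutation.
Variables (rho : nat) (G : groupType) (a b : G).
Local Open Scope group_scope.
Hypothesis ab : a * b = b * a ^+ rho.

Lemma meta_shift x j : a ^+ x * b ^+ j = b ^+ j * a ^+ (rho ^ j * x).
Proof.
have shift1 y : a ^+ y * b = b * a ^+ (rho * y).
  elim: y => [|y IHy]; first by rewrite muln0 mul1g mulg1.
  by rewrite expgSr -mulgA ab mulgA IHy -mulgA -expgnDr mulnS addnC.
elim: j => [|j IHj]; first by rewrite mul1g mul1n mulg1.
by rewrite expgSr mulgA IHj -mulgA shift1 mulgA mulnA -expnS.
Qed.

Lemma meta_mul i x j y :
  (b ^+ i * a ^+ x) * (b ^+ j * a ^+ y) = b ^+ (i + j) * a ^+ (rho ^ j * x + y).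
Proof.
by rewrite -mulgA (mulgA (a ^+ x)) meta_shift !mulgA -expgnDr -mulgA -expgnDr.
Qed.

(** Collecting the [b]s on the left conjugates the [i]-th exponent by the
    [m - i - 1] copies of [b] that stand to its right. *)
Lemma meta_prod m (e : nat -> nat) :
  \prod_(0 <= i < m) (b * a ^+ e i) =
  b ^+ m * a ^+ (\sum_(0 <= i < m) rho ^ (m - i.+1) * e i).
Proof.
elim: m => [|m IHm]; first by rewrite !big_nil mulg1.
rewrite big_nat_recr //= IHm -[b * _]/(b ^+ 1 * _) meta_mul addn1.
congr (_ * _ ^+ _); rewrite [RHS]big_nat_recr //= subnn mul1n; congr (_ + _).
rewrite expn1 big_distrr; apply: eq_big_nat => i /andP[_ im] /=.
by rewrite mulnA -expnS -subSn.
Qed.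

End Commutation.

Section MetacyclicRelations.
Variables (n M rho s : nat) (G : groupType).
Local Open Scope group_scope.

(** The relation [a b = b a^rho] is used in place of [b a b^-1 = a^R], since
    [rho] is a natural number that is known explicitly, whereas [R] is an integer
    known as an inverse of it. *)
Definition meta_rel (a b : G) : Prop :=
  [/\ a ^+ M = 1, a * b = b * a ^+ rho & b ^+ n = a ^+ s].

Definition meta_normal (a b g : G) : Prop := exists i x, g = b ^+ i * a ^+ x.

Variables a b : G.
Hypothesis rel_ab : meta_rel a b.

Let aM : a ^+ M = 1. Proof. by case: rel_ab. Qed.
Let ab : a * b = b * a ^+ rho. Proof. by case: rel_ab. Qed.
Let bn : b ^+ n = a ^+ s. Proof. by case: rel_ab. Qed.

Hypotheses (n_gt0 : 0 < n) (M_gt0 : 0 < M).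

Lemma meta_normal_lt g :
  meta_normal a b g -> exists i x, i < n /\ g = b ^+ i * a ^+ x.
Proof.
move=> [i [x ->]]; exists (i %% n), (rho ^ (i %% n) * (s * (i %/ n)) + x)%N.
split; first exact: ltn_pmod.
rewrite {1}(divn_eq i n) expgnDr [(i %/ n * n)%N]mulnC expgnA bn -expgnA.
by rewrite (meta_shift ab) -mulgA -expgnDr.
Qed.

Lemma meta_normal1 : meta_normal a b 1.
Proof. by exists 0, 0; rewrite mulg1. Qed.

Lemma meta_normalM g h : meta_normal a b g -> meta_normal a b h -> meta_normal a b (g * h).
Proof. by move=> [i [x ->]] [j [y ->]]; rewrite (meta_mul ab); do 2!eexists. Qed.

Let expg_inv (c : G) m x : 0 < m -> c ^+ m = 1 -> c ^- x = c ^+ (m.-1 * x).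
Proof.
move=> m_gt0 cm; apply: mulg1_eq.
by rewrite -expgnDr -mulSn prednK // expgnA cm expg1n.
Qed.

(** Both generators have finite order, so inverses are positive powers, and
    the normal forms are closed under them. *)
Lemma meta_normalV g : meta_normal a b g -> meta_normal a b g^-1.
Proof.
have bnM : b ^+ (n * M) = 1 by rewrite expgnA bn expgnAC aM expg1n.
move=> [i [x ->]]; rewrite invgM (expg_inv _ _ aM) // (expg_inv _ _ bnM) ?muln_gt0 ?n_gt0 //.
by rewrite (meta_shift ab); do 2!eexists.
Qed.

Hypothesis normal_ab : forall g, meta_normal a b g.

(** The cyclic normal subgroup is generated by [a]; as [a] has finite order, its
    integer powers are its natural powers, which [meta_shift] conjugates. *)
Lemma meta_metacyclic : metacyclic_group G.
Proof.
have aP z : exists x, expgz a z = a ^+ x.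
  case: z => m; first by exists m.
  by exists (M.-1 * m.+1)%N; rewrite -(expg_inv _ M_gt0 aM).
exists (range (expgz a)); split; last first.
- exists b => g; have [i [x ->]] := normal_ab g.
  by exists (Posz i), (Posz x); rewrite //= mulKg.
- by exists a.
split.
  split; first by exists (Posz 0).
    move=> _ _ [y _ <-] [z _ <-]; have [[i ->] [j ->]] := (aP y, aP z).
    by exists (Posz (i + j)); rewrite //= expgnDr.
  move=> _ [y _ <-]; have [i ->] := aP y.
  by exists (Posz (M.-1 * i)); rewrite //= -expg_inv.
move=> _ g [y _ <-]; have [{}y ->] := aP y.
have [i [x gE]] := normal_ab g^-1.
exists (Posz (rho ^ i * y)); rewrite //= -{1}[g]invgK gE invgM.
rewrite -!mulgA; apply: (mulgI (b ^+ i * a ^+ x)); rewrite -[LHS]mulgA.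
rewrite -[RHS](mulgA) mulVKg mulVKg -expgnDr mulgA (meta_shift ab).
by rewrite -mulgA -expgnDr addnC.
Qed.

End MetacyclicRelations.

Section ModelIso.
Variables (n M rho s : nat) (h : affine_params n M rho).
Hypothesis ns : n * s = gsum rho n %[mod n * M].
Local Open Scope group_scope.

Let n_gt0 : 0 < n. Proof. by case/and4P: h. Qed.
Let M_gt0 : 0 < M. Proof. by case/and4P: h. Qed.
Let rho1 : rho = 1 %[mod n]. Proof. by case/and4P: h => _ _ /eqP. Qed.

Lemma affine_meta_rel : meta_rel n M rho s (affine_elt h n) (affine_elt h 1).
Proof.
split.
- by rewrite affine_expX -affine_elt1; apply/affine_eltP; rewrite modnn mod0n.
- rewrite affine_expX affine_translation affine_eltM expn1.
  by rewrite addnC mulnC.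
- by rewrite affine_expX affine_exp1; apply/affine_eltP.
Qed.

(** The element [b^i a^x] goes to [gsum rho i + n x].  This is [i] modulo [n], so
    its residue determines [i < n] and then [x] modulo [M], which gives
    injectivity; and [x] can be adjusted to reach any residue. *)
Lemma meta_model_bijective (G : groupType) (a b : G)
    (phi : UMagmaMorphism.type G (affine_group h)) :
  meta_rel n M rho s a b -> (forall g, meta_normal a b g) ->
  phi a = affine_elt h n -> phi b = affine_elt h 1 -> bijective phi.
Proof.
move=> rel_ab nf phia phib; have [aM _ _] := rel_ab.
have phiE i x : phi (b ^+ i * a ^+ x) = affine_elt h (gsum rho i + n * x).
  by rewrite gmulfM !gmulfXn phia phib affine_expX affine_exp1 affine_translation.
have inj_phi : injective phi.
  apply: gmulf_inj => g.
  have [i [x [lt_in ->]]] := meta_normal_lt rel_ab n_gt0 (nf g).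
  rewrite phiE -affine_elt1 => /affine_eltP; rewrite mod0n => /eqP.
  rewrite -/(dvdn _ _) => dvd_N.
  have i0 : i = 0.
    have: n %| gsum rho i + n * x by apply: dvdn_trans dvd_N; apply: dvdn_mulr.
    rewrite dvdn_addl ?dvdn_mulr // /dvdn (gsum_mod i rho1) modn_small //.
    by move/eqP.
  move: dvd_N; rewrite i0 /gsum big_ord0 add0n dvdn_pmul2l // => /dvdnP[y ->].
  by rewrite mul1g mulnC expgnA aM expg1n.
have surj y : exists g, phi g = y.
  rewrite -[y]affine_valK; move: (affine_val y) => {}y.
  (* Multiplication by (n M).-1 is negation modulo n M, so the quotient x
     below is that of y - gsum rho y by n. *)
  have: n %| y + (n * M).-1 * gsum rho y.
    rewrite /dvdn -modnDmr -modnMmr (gsum_mod y rho1) modnMmr modnDmr -mulSn prednK.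
      by rewrite -mulnA modnMr.
    by rewrite muln_gt0 n_gt0.
  move=> /dvdnP[x xE]; exists (b ^+ y * a ^+ x); rewrite phiE; apply/affine_eltP.
  rewrite [(n * x)%N]mulnC -xE addnCA -mulSn prednK ?muln_gt0 ?n_gt0 //.
  by rewrite -modnDmr modnMr addn0.
have [psi psiK] := choice surj.
by exists psi => // g; apply: inj_phi.
Qed.

End ModelIso.

Lemma group_iso_via (G H K : groupType) (f : UMagmaMorphism.type G K)
    (g : UMagmaMorphism.type H K) :
  bijective f -> bijective g -> group_iso G H.
Proof.
move=> bij_f [g' gK g'K].
have g'M : {morph (g' \o f) : x y / (x * y)%g}.
  by move=> x y; rewrite /= gmulfM (can2_gmulfM gK g'K).
pose m := isMultiplicative.Build G H (g' \o f) g'M.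
exists (HB.pack_for {multiplicative G -> H} (g' \o f) m).
by apply: bij_comp => //; exists g.
Qed.

Lemma card_bijective_ord (T : Type) N (f : T -> 'I_N) :
  bijective f -> ([set: T]%classic #= `I_N)%card.
Proof.
move=> /PbijTT[g _]; apply: card_eq_trans (card_esym card_II).
exact: (pcard_eq g).
Qed.

(** * The numbers attached to r, n and alpha *)

Section CyclicArithmetic.
Variables n r alpha kappa : nat.
Hypotheses (n_gt0 : 0 < n) (r_gt1 : 1 < r) (r1 : r = 1 %[mod n]).
Hypothesis alphakappa : alpha * kappa = 1 %[mod n].

Let q := r.-1 %/ n.
Let s := gsum r n %/ n.
Let M := q * gsum r n.
Let rho := r ^ alpha.

Lemma mul_n_q : n * q = r.-1.
Proof.
by rewrite mulnC divnK // -subn1 -eqn_mod_dvd ?r1 // ltnW.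
Qed.

Lemma mul_n_s : n * s = gsum r n.
Proof. by rewrite mulnC divnK // /dvdn (gsum_mod n r1) modnn. Qed.

Lemma gsum_r_telescope t : n * q * gsum r t + 1 = r ^ t.
Proof. by rewrite mul_n_q gsum_telescope // ltnW. Qed.

Lemma mul_n_M : n * M + 1 = r ^ n.
Proof. by rewrite mulnA gsum_r_telescope. Qed.

Lemma expn_n_mod : r ^ n = 1 %[mod n * M].
Proof. by rewrite -mul_n_M modnDl. Qed.

Lemma quotient_gt0 : 0 < M.
Proof.
have: 1 < r ^ n by rewrite -{1}(expn0 r) ltn_exp2l.
by rewrite -mul_n_M addn1 ltnS muln_gt0 => /andP[].
Qed.

Lemma coprime_n_alpha : coprime n alpha.
Proof.
rewrite /coprime -dvdn1; set d := gcdn n alpha.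
have dn : d %| n := dvdn_gcdl _ _.
suff -> : (d %| 1) = (d %| alpha * kappa) by apply/dvdn_mulr/dvdn_gcdr.
by rewrite /dvdn -(modn_dvdm 1 dn) -(modn_dvdm (_ * _) dn) alphakappa.
Qed.

Lemma affine_params_r : affine_params n M rho.
Proof.
rewrite /affine_params n_gt0 quotient_gt0 /=; apply/andP; split; apply/eqP.
  by rewrite /rho -modnXm r1 modnXm exp1n.
by rewrite -expnM (expn_mod_period expn_n_mod (j := 0)) // modnMl mod0n.
Qed.

(** Multiplication by [alpha] permutes the residues modulo [n], and [r ^ i] modulo
    [r ^ n - 1] depends only on [i] modulo [n]; so the two sums have the same
    terms in a different order. *)
Lemma gsum_rho : gsum rho n = gsum r n %[mod n * M].
Proof.
pose f (i : 'I_n) : 'I_n := Ordinal (ltn_pmod (alpha * i) n_gt0).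
have f_inj : injective f.
  move=> i j /(congr1 val) /= /eqP ij; apply: val_inj.
  wlog le_ij : i j ij / i <= j.
    move=> wl; have [|/ltnW] := leqP i j => [|ji]; first exact: wl.
    by apply/esym/wl; rewrite // eq_sym.
  move: ij; rewrite eq_sym eqn_mod_dvd ?leq_mul2l ?le_ij ?orbT // -mulnBr.
  rewrite Gauss_dvdr ?coprime_n_alpha // => dvd_ji; apply/eqP; rewrite eqn_leq le_ij -subn_eq0.
  by apply: contraLR dvd_ji => ?; rewrite gtnNdvd ?lt0n //; have := ltn_ord j; lia.
rewrite /gsum [in RHS](reindex_inj f_inj) /=.
rewrite -[LHS]modn_summ -[RHS]modn_summ; congr (_ %% _); apply: eq_bigr => i _.
by rewrite -expnM; apply: expn_mod_period expn_n_mod _; rewrite modn_mod.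
Qed.

Lemma ns_rho : n * s = gsum rho n %[mod n * M].
Proof. by rewrite gsum_rho mul_n_s. Qed.

(** The exponent [e] for which the generator with index [kappa * t] is [b a^e]. *)
Definition cyc_exponent (t : nat) := q * rho * gsum r t.

(** The arithmetic behind both [b^n = a^s] and its converse: a product of [n]
    consecutive elements [b a^e] is [b^n] times the power of [a] whose exponent
    is this sum.  After multiplication by [n], the exponent
    [n * cyc_exponent t] is [rho * (r ^ t - 1)], and the terms
    [rho ^ (n - j) * r ^ (alpha * (i + j))] no longer depend on [j]. *)
Lemma product_exponent i :
  s + \sum_(0 <= j < n) rho ^ (n - j.+1) * cyc_exponent (alpha * (i + j)) =
  r ^ (alpha * i) %[mod M].
Proof.
set E := \sum_(0 <= j < n) _; apply/eqP.
suff: n * (s + E) == n * r ^ (alpha * i) %[mod n * M].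
  by rewrite -!muln_modr eqn_pmul2l.
have nE : n * E + rho * gsum rho n = n * (rho ^ n * r ^ (alpha * i)).
  rewrite /E /gsum -(big_mkord xpredT (fun i => rho ^ i)).
  rewrite [X in _ + _ * X]big_nat_rev !big_distrr -big_split /=.
  transitivity (\sum_(0 <= j < n) rho ^ n * r ^ (alpha * i)); last first.
    by rewrite sum_nat_const_nat subn0.
  apply: eq_big_nat => j /andP[_ jn]; rewrite add0n.
  transitivity (rho ^ (n - j.+1) * rho * (n * q * gsum r (alpha * (i + j)) + 1)).
    by rewrite /cyc_exponent; ring.
  rewrite gsum_r_telescope mulnDr expnD.
  have -> : rho ^ n = rho ^ (n - j.+1) * rho * r ^ (alpha * j).
    by rewrite [r ^ _]expnM -expnSr -expnD; congr (_ ^ _); lia.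
  ring.
have rho_gsum : rho * gsum rho n = n * s %[mod n * M].
  rewrite ns_rho; apply/eqP; rewrite -(eqn_modDl 1) -gsumSl gsumS addnC.
  rewrite eqn_modDr -expnM (expn_mod_period expn_n_mod (j := 0)) //.
  by rewrite modnMl mod0n.
rewrite mulnDr -modnDml -rho_gsum modnDml addnC nE [(_ * r ^ _)%N]mulnC mulnA.
rewrite -modnMmr -expnM (expn_mod_period expn_n_mod (j := 0)) ?modnMl ?mod0n //.
by rewrite modnMmr muln1.
Qed.

(** * From the cyclic relations to the metacyclic ones *)

Section CyclicRelations.
Variable G : groupType.
Local Open Scope group_scope.

Definition window (y : nat -> G) (i m : nat) : G := \prod_(0 <= j < m) y (i + j)%N.

Definition cyc_rel (y : nat -> G) : Prop :=
  (forall i, y (i + n) = y i) /\ (forall i, window y i r = y (i + kappa)%N).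

Lemma window_recl y i m : window y i m.+1 = y i * window y i.+1 m.
Proof.
rewrite /window big_nat_recl // addn0; congr (_ * _).
by apply: eq_bigr => j _; rewrite addnS.
Qed.

Lemma window_cat y i m1 m2 : window y i (m1 + m2) = window y i m1 * window y (i + m1) m2.
Proof.
elim: m1 i => [|m1 IH] i; first by rewrite /window big_nil mul1g addn0.
by rewrite addSn !window_recl IH mulgA addSnnS.
Qed.

Lemma window1 y i : window y i 1 = y i.
Proof. by rewrite /window big_nat1 addn0. Qed.

Section Periodic.
Variable y : nat -> G.
Hypothesis y_per : forall i, y (i + n) = y i.

Lemma periodic_mod i j : i = j %[mod n] -> y i = y j.
Proof.
have red k : y k = y (k %% n).
  rewrite {1}(divn_eq k n) addnC; elim: (k %/ n) => [|m IHm]; first by rewrite addn0.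
  by rewrite mulSnr addnA y_per.
by move=> ij; rewrite red ij -red.
Qed.

Lemma window_mod m i j : i = j %[mod n] -> window y i m = window y j m.
Proof.
move=> ij; apply: eq_bigr => k _; apply: periodic_mod.
by rewrite -modnDml ij modnDml.
Qed.

(** As [r = n q + 1], the word of length [r] goes [q] times around the cycle and
    takes one more letter. *)
Lemma window_r i : window y i r = window y i n ^+ q * y i.
Proof.
have -> : r = (n * q).+1 by rewrite mul_n_q prednK // ltnW.
rewrite -addn1 window_cat window1 (periodic_mod (j := i)) ?[(n * q)%N]mulnC ?modnMDl //.
  congr (_ * _); elim: q => [|t IH]; first by rewrite /window big_nil.
  rewrite mulSnr window_cat IH expgSr; congr (_ * _); apply: window_mod.
  by rewrite addnC modnMDl.
by rewrite addnC modnMDl.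
Qed.

Lemma window_rot i : window y i n * y i = y i * window y i.+1 n.
Proof.
by rewrite -window_recl -addn1 window_cat window1 y_per.
Qed.

Lemma window_conj m i : window y i n * window y i m = window y i m * window y (i + m) n.
Proof.
elim: m i => [|m IHm] i; first by rewrite /window !big_nil mul1g mulg1 addn0.
by rewrite window_recl mulgA window_rot -mulgA IHm mulgA addSnnS.
Qed.

Lemma window_conjX m i k :
  window y i n ^+ k * window y i m = window y i m * window y (i + m) n ^+ k.
Proof.
elim: k => [|k IHk]; first by rewrite mul1g mulg1.
by rewrite expgS -mulgA IHk mulgA window_conj -mulgA -expgS.
Qed.

Section Forward.
Hypothesis y_rel : forall i, window y i r = y (i + kappa)%N.

Let a := window y 0 n.
Let b := y 0.

Lemma y_shift i : y (i + kappa) = window y i n ^+ q * y i.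
Proof. by rewrite -y_rel window_r. Qed.

(** Each [y_(i+kappa+j)] is [P_(i+j)^q y_(i+j)], and carrying [P_(i+j)^q] to the
    left of [y_i ... y_(i+j-1)] turns it into [P_i^q].  The [n] factors contribute
    [P_i^(n q)] in total. *)
Lemma window_kappa i : window y (i + kappa) n = window y i n ^+ r.
Proof.
suff shift m : window y (i + kappa) m = window y i n ^+ (m * q) * window y i m.
  by rewrite shift mul_n_q -expgSr prednK // ltnW.
elim: m => [|m IHm]; first by rewrite /window !big_nil mulg1.
rewrite -addn1 !window_cat !window1 IHm addnAC y_shift !mulgA.
rewrite -[_ * _ ^+ q]mulgA -window_conjX !mulgA -expgnDr.
by rewrite addn1 mulSnr.
Qed.

Lemma window_kappaX j : window y (kappa * j) n = a ^+ (r ^ j).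
Proof.
elim: j => [|j IHj]; first by rewrite muln0.
by rewrite mulnS addnC window_kappa IHj -expgnA expnSr.
Qed.

(** All windows are powers of a single one because [kappa] generates the
    indices modulo [n]: [i] is [kappa * (alpha * i)]. *)
Lemma window_alpha i : window y i n = a ^+ (r ^ (alpha * i)).
Proof.
rewrite -window_kappaX; apply: window_mod.
by rewrite mulnA -modnMml [(kappa * alpha)%N]mulnC alphakappa modnMml mul1n.
Qed.

Lemma cyc_normal_kappa j : y (kappa * j) = b * a ^+ (q * rho * gsum r j).
Proof.
elim: j => [|j IHj]; first by rewrite muln0 /gsum big_ord0 muln0 mulg1.
rewrite mulnS addnC y_shift -[y (kappa * j)]window1 window_conjX window1.
rewrite (@window_mod _ _ (kappa * (j + alpha))); last first.
  by rewrite mulnDr -modnDmr -alphakappa modnDmr [(alpha * _)%N]mulnC.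
rewrite window_kappaX IHj -mulgA -expgnA -expgnDr gsumS expnD.
by congr (_ * _ ^+ _); rewrite /rho; ring.
Qed.

Lemma cyc_normal i : y i = b * a ^+ cyc_exponent (alpha * i).
Proof.
rewrite -cyc_normal_kappa; apply: periodic_mod.
by rewrite mulnA -modnMml [(kappa * alpha)%N]mulnC alphakappa modnMml mul1n.
Qed.

(** For [j = n], [window_kappaX] and [cyc_normal_kappa] compare an
    element with itself after a full turn around the cycle; the first gives the exponent
    [n M = r^n - 1] for [a], the second improves it to [M]. *)
Lemma cyc_rel_meta : meta_rel n M rho s a b.
Proof.
have aN : a ^+ (n * M) = 1.
  have := window_kappaX n; rewrite (@window_mod _ _ 0) ?modnMl ?mod0n //.
  by rewrite -mul_n_M expgnDr expg1 -{1}[window _ _ _]mul1g => /mulIg.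
have rhon : rho ^ n = 1 %[mod n * M].
  by case/and4P: affine_params_r => _ _ _ /eqP.
have aM : a ^+ M = 1.
  (* The full turn kills a ^ (rho * M), and rho is invertible modulo n M. *)
  have: y (kappa * n) = b by apply: periodic_mod; rewrite modnMl mod0n.
  rewrite cyc_normal_kappa -[RHS]mulg1 => /mulgI aqn.
  rewrite -[M]mul1n -(expg_mod_period aN (i := (rho ^ n * M))); last first.
    by rewrite -modnMml rhon modnMml.
  have -> : (rho ^ n * M = q * rho * gsum r n * rho ^ n.-1)%N.
    by rewrite -{1}(prednK n_gt0) expnSr /M; ring.
  by rewrite expgnA aqn expg1n.
have ab : a * b = b * a ^+ rho.
  by rewrite window_rot window_alpha muln1.
split=> //; have /(expg_mod_period aM) := product_exponent 0.
(* Now a ^ (s + E) = a, whereas a, as the product of all the generators, is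
   b ^ n * a ^ E. *)
set E := \sum_(0 <= j < n) _; rewrite muln0 expg1 expgnDr => aE.
have bnE : a = b ^+ n * a ^+ E.
  by rewrite -(meta_prod ab); apply: eq_bigr => i _; rewrite cyc_normal.
by apply: (mulIg (a ^+ E)); rewrite -bnE aE.
Qed.

End Forward.
End Periodic.

(** * From the metacyclic relations back to the cyclic ones *)

Section Backward.
Variables a b : G.
Hypothesis rel_ab : meta_rel n M rho s a b.

Definition cyc_elt (i : nat) : G := b * a ^+ cyc_exponent (alpha * i).

Let aM : a ^+ M = 1. Proof. by case: rel_ab. Qed.
Let ab : a * b = b * a ^+ rho. Proof. by case: rel_ab. Qed.

(** A full turn adds a multiple of [q * gsum r n = M] to the exponent. *)
Lemma cyc_exponent_mod i j : i = j %[mod n] -> a ^+ cyc_exponent i = a ^+ cyc_exponent j.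
Proof.
have per k : a ^+ cyc_exponent (k + n) = a ^+ cyc_exponent k.
  apply: (expg_mod_period aM); rewrite /cyc_exponent gsumD.
  have -> : (q * rho * (gsum r k + r ^ k * gsum r n) =
             rho * r ^ k * M + q * rho * gsum r k)%N by rewrite /M; ring.
  by rewrite modnMDl.
exact: (@periodic_mod (fun k => a ^+ cyc_exponent k) per).
Qed.

Lemma cyc_elt_window i : window cyc_elt i n = a ^+ (r ^ (alpha * i)).
Proof.
rewrite /window /cyc_elt (meta_prod ab n (fun j => cyc_exponent (alpha * (i + j)))).
have [_ _ ->] := rel_ab; rewrite -expgnDr.
by apply: (expg_mod_period aM); apply: product_exponent.
Qed.

(** With [P_i = a ^ (r ^ (alpha * i))], the relation [P_i^q y_i = y_(i+kappa)]
    becomes the recursion [gsum r t.+1 = gsum r t + r ^ t], because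
    [alpha * (i + kappa)] is [alpha * i + 1] modulo [n]. *)
Lemma cyc_elt_rel : cyc_rel cyc_elt.
Proof.
have per i : cyc_elt (i + n) = cyc_elt i.
  by congr (_ * _); apply: cyc_exponent_mod; rewrite mulnDr addnC modnMDl.
split=> // i; rewrite window_r // cyc_elt_window /cyc_elt.
rewrite -expgnA mulgA -[b in LHS]expg1 (meta_shift ab) -mulgA -expgnDr; congr (_ * _).
rewrite (@cyc_exponent_mod (alpha * (i + kappa)) (alpha * i).+1); last first.
  by rewrite mulnDr -modnDmr alphakappa modnDmr addn1.
congr (_ ^+ _); rewrite /cyc_exponent gsumS expn1; ring.
Qed.

Lemma cyc_elt0 : cyc_elt 0 = b.
Proof. by rewrite /cyc_elt muln0 /cyc_exponent /gsum big_ord0 muln0 mulg1. Qed.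

Lemma cyc_elt_window0 : window cyc_elt 0 n = a.
Proof. by rewrite cyc_elt_window muln0. Qed.

End Backward.

End CyclicRelations.
End CyclicArithmetic.

(** * The relators of the two presentations *)

Section CyclicWords.
Variables (m r : nat) (k : int) (G : groupType).
Let n := m.+1.
Local Open Scope group_scope.

Let kappa : nat := `|((r%:Z + k - 1) %% n%:Z)%Z|%N.

(** Generators read as a periodic sequence, so that subscripts are added as
    natural numbers. *)
Definition cyc_fun (f : 'I_n -> G) (i : nat) : G := f (inord (i %% n)).

Lemma cyc_fun_period f i : cyc_fun f (i + n) = cyc_fun f i.
Proof. by rewrite /cyc_fun modnDr. Qed.

Lemma iter_ordS i j : iter i (@ordS n) (inord (j %% n) : 'I_n) = inord ((i + j) %% n).
Proof.
elim: i => [//|i /= ->]; apply: val_inj; rewrite /= !inordK ?ltn_pmod //.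
by rewrite -addn1 modnDml addSn addn1.
Qed.

Lemma word_eval_theta (f : 'I_n -> G) i w :
  word_eval f (iter i (@theta n) w) = word_eval (fun x => f (iter i (@ordS n) x)) w.
Proof.
elim: i w => [//|i IHi] w; rewrite iterSr IHi /word_eval /theta big_map.
by apply: eq_bigr => l _; rewrite /letter_eval /= -iterSr.
Qed.

(** The word whose shifts are the relators of [F_group]. *)
Definition F_relator := step_word n r 0 1 ++ winv (step_word n 1 (r%:Z + k - 1)%R 1).

Lemma F_relator_eval (f : 'I_n -> G) i :
  word_eval f (iter i (@theta n) F_relator) =
  window (cyc_fun f) i r * (cyc_fun f (i + kappa))^-1.
Proof.
rewrite word_eval_theta word_eval_cat word_eval_winv; congr (_ * _^-1).
  rewrite /window /step_word /word_eval big_map /index_iota subn0.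
  apply: eq_bigr => j _; rewrite /letter_eval /= add0r mulr1 modz_nat absz_nat.
  by rewrite iter_ordS.
rewrite /step_word /= word_eval1 mul0r addr0.
rewrite -[`|_|%N](@modn_small _ n); first by rewrite iter_ordS.
by rewrite -ltz_nat gez0_abs ?modz_ge0 // ltz_pmod.
Qed.

Lemma F_relatorsP (f : 'I_n -> G) :
  {in traject (@theta n) F_relator n, forall w, word_eval f w = 1%g} <->
  cyc_rel n r kappa (cyc_fun f).
Proof.
split=> [relf|[_ relf] _ /trajectP[i _ ->]]; last first.
  by rewrite F_relator_eval relf mulgV.
split=> [|i]; first exact: cyc_fun_period.
rewrite (window_mod (cyc_fun_period f) _ (j := i %% n)) ?modn_mod //.
rewrite (periodic_mod (cyc_fun_period f) (j := i %% n + kappa)) ?modnDml //.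
apply: divg1_eq; rewrite -F_relator_eval relf //.
by apply/trajectP; exists (i %% n); rewrite ?ltn_pmod.
Qed.

End CyclicWords.

Lemma expgz_mod (G : groupType) (a : G) M z :
  0 < M -> (a ^+ M = 1)%g -> expgz a z = (a ^+ `|(z %% M%:Z)%Z|%N)%g.
Proof.
move=> M_gt0 aM; case: z => m /=.
  by rewrite modz_nat absz_nat; apply: (expg_mod_period aM); rewrite modn_mod.
apply: mulg1_eq; rewrite -expgnDr -[RHS](expg0 a); apply: (expg_mod_period aM).
have := divz_eq (Negz m) M; have : (0 <= (Negz m %% M)%Z)%R by rewrite modz_ge0 // -lt0n.
case: (Negz m %% M)%Z => // t _ /= e; apply/eqP; rewrite mod0n -/(dvdn _ _).
suff: (M%:Z %| Posz (m.+1 + t))%Z by [].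
by apply/dvdzP; exists (- (Negz m %/ M)%Z)%R; move: e; rewrite NegzE; lia.
Qed.

(** The relators in the definition of [B_group], named so that they can be
    evaluated in an arbitrary group. *)
Definition B_relators (M N R lam : int) : seq (word 'I_2) :=
  let a : word 'I_2 := [:: (ord0, false)] in
  let b : word 'I_2 := [:: (ord_max, false)] in
    [:: wpow a M;
        b ++ a ++ winv b ++ winv (wpow a R);
        wpow b N ++ winv (wpow a (lam * M %/ gcdz M (R - 1)%R)%Z) ].

Section MetacyclicPresentation.
Variables (n M rho s : nat) (R : int).
Hypotheses (M_gt0 : 0 < M) (R_rho : ((R * rho)%R = 1%R %[mod M])%Z).
Hypothesis gcdE : ((1 * M)%R %/ gcdz M (R - 1)%R)%Z = s.
Variables (G : groupType).
Local Open Scope group_scope.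

(** Conjugation by [b] maps [a] to [a^R] if and only if it maps [a^rho] to [a],
    because [R] and [rho] are inverse modulo the exponent [M] of [a]. *)
Lemma B_relatorsP (f : 'I_2 -> G) :
  {in B_relators M n R 1, forall w, word_eval f w = 1%g} <->
  meta_rel n M rho s (f ord0) (f ord_max).
Proof.
set a := f ord0; set b := f ord_max.
pose R' := `|(R %% M)%Z|%N.
have R'rho : R' * rho = 1 %[mod M].
  apply/eqP; rewrite -eqz_nat -!modz_nat PoszM /R' gez0_abs ?modz_ge0 -?lt0n //.
  by rewrite modzMml R_rho.
pose wa : word 'I_2 := [:: (ord0, false)]; pose wb : word 'I_2 := [:: (ord_max, false)].
have -> : B_relators M n R 1 = [:: wpow wa M; wb ++ wa ++ winv wb ++ winv (wpow wa R);
    wpow wb n ++ winv (wpow wa s)] by rewrite /B_relators gcdE.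
have ev0 : word_eval f (wpow wa M) = a ^+ M by rewrite word_eval_wpow word_eval1.
have ev1 : word_eval f (wb ++ wa ++ winv wb ++ winv (wpow wa R)) =
    b * a * b^-1 * (expgz a R)^-1.
  by rewrite !word_eval_cat !word_eval_winv word_eval_wpow !word_eval1 !mulgA.
have ev2 : word_eval f (wpow wb n ++ winv (wpow wa s)) = b ^+ n * a ^- s.
  by rewrite word_eval_cat word_eval_winv !word_eval_wpow !word_eval1.
split=> [rels1|[aM ab bn] w].
  have aM : a ^+ M = 1 by rewrite -ev0 rels1 // !inE eqxx ?orbT.
  have bab : b * a * b^-1 = a ^+ R'.
    by apply: divg1_eq; rewrite -expgz_mod // -ev1 rels1 // !inE eqxx ?orbT.
  split=> //; last by apply: divg1_eq; rewrite -ev2 rels1 // !inE eqxx ?orbT.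
  have: (a ^+ rho) ^ b^-1 = a.
    rewrite conjXg conjgE invgK mulgA bab -expgnA.
    exact: (expg_mod_period (j := 1) aM).
  by move/(canRL (conjgKV b)) => ->; exact: conjgC.
have bab : b * a * b^-1 = a ^+ R'.
  have arho : (a ^+ rho) ^ b^-1 = a by rewrite conjgE invgK mulgA -ab mulgK.
  rewrite -{2}arho -conjXg conjgE invgK mulgA -expgnA mulnC.
  by rewrite (expg_mod_period (j := 1) aM R'rho).
rewrite !inE => /or3P[] /eqP->.
- by rewrite -[RHS]aM -ev0.
- by rewrite ev1 (expgz_mod R M_gt0 aM) bab mulgV.
- by rewrite ev2 bn mulgV.
Qed.
End MetacyclicPresentation.

(** * The parameters R and M / gcd(M, R - 1) *)

Section Integers.
Local Open Scope ring_scope.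

Lemma eqz_mod_nat (i j d : nat) : (i = j %[mod d]) <-> (i = j %[mod d%:Z])%Z.
Proof. by rewrite !modz_nat; split=> [->//|[]]. Qed.

Lemma Posz_expn (m i : nat) : (m ^ i)%N%:Z = m%:Z ^+ i.
Proof. by elim: i => [//|i IHi]; rewrite expnS exprS PoszM IHi. Qed.

Section Powers.
Variables (n r : nat) (A R : int).
Hypotheses (n_gt0 : (0 < n)%N) (r_gt0 : (0 < r)%N).
Let N : int := r%:Z ^+ n - 1.
Let alpha := `|(A %% n%:Z)%Z|%N.

Lemma alpha_mod : (alpha%:Z = A %[mod n%:Z])%Z.
Proof. by rewrite /alpha gez0_abs ?modz_ge0 -?lt0n // modz_mod. Qed.

Lemma expn_r_mod i j : (i = j %[mod n])%N -> ((r ^ i)%N%:Z = (r ^ j)%N %[mod N])%Z.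
Proof.
have -> : N = (r ^ n - 1)%N.
  by rewrite /N -Posz_expn subzn ?expn_gt0 ?r_gt0.
move=> ij; apply/eqz_mod_nat; apply: expn_mod_period ij.
by apply/eqP; rewrite eqn_mod_dvd ?expn_gt0 ?r_gt0.
Qed.

(** [R] is [r ^ ((n - 1) A)] and [alpha] is [A] modulo [n], so that [R * r ^ alpha]
    is [r ^ (n A)], which is [1] modulo [r ^ n - 1]. *)
Lemma powmod_inverse :
  is_powmod N r%:Z ((n%:Z - 1) * A) R -> (R * (r ^ alpha)%N%:Z = 1 %[mod N])%Z.
Proof.
have alphaA := alpha_mod.
case E: ((n%:Z - 1) * A) => [d|d] /= Rd.
- rewrite -modzMml Rd modzMml -Posz_expn -PoszM -expnD (@expn_r_mod _ 0) //.
  apply/eqz_mod_nat; rewrite PoszD -E -modzDmr alphaA modzDmr.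
  by apply/eqP; rewrite eqz_mod_dvd; apply/dvdzP; exists A; ring.
- rewrite -modzMmr (@expn_r_mod _ d.+1) ?modzMmr ?Posz_expn //.
  apply/eqz_mod_nat; rewrite alphaA; apply/eqP; rewrite eqz_mod_dvd; apply/dvdzP.
  by exists A; move: E; rewrite NegzE => E; rewrite -[Posz d.+1]opprK -E; ring.
Qed.

End Powers.

Section Gcd.
Variables (n r alpha kappa : nat) (R : int).
Hypotheses (r_gt1 : (1 < r)%N) (r1 : (r = 1 %[mod n])%N).
Hypothesis alphakappa : (alpha * kappa = 1 %[mod n])%N.
Let M := (r.-1 %/ n * gsum r n)%N.
Let s := (gsum r n %/ n)%N.
Hypothesis R_rho : (R * (r ^ alpha)%N%:Z = 1 %[mod (n * M)%N%:Z])%Z.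

(** [R = 1] modulo [d] means [r ^ alpha = 1] modulo [d]; together with [r ^ n = 1]
    and the invertibility of [alpha] modulo [n] this forces [r = 1] modulo [d]. *)
Lemma R_eq1_mod (d : nat) : (d %| n * M)%N ->
  (R = 1 %[mod d%:Z])%Z <-> (r = 1 %[mod d])%N.
Proof.
move=> dN.
have mod_d (x y : int) : (x = y %[mod (n * M)%N%:Z])%Z -> (x = y %[mod d%:Z])%Z.
  move/eqP; rewrite eqz_mod_dvd => h; apply/eqP; rewrite eqz_mod_dvd.
  by apply: dvdz_trans h.
have R_rho_d := mod_d _ _ R_rho.
split=> [R1|rd].
  have rho1 : (r ^ alpha = 1 %[mod d])%N.
    by apply/eqz_mod_nat; rewrite -R_rho_d -modzMml R1 modzMml mul1r.
  have rn : (r ^ n = 1 %[mod d])%N.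
    by rewrite -(modn_dvdm _ dN) (expn_n_mod r_gt1 r1) modn_dvdm.
  rewrite -[r in LHS]expn1 (expn_mod_period rn (esym alphakappa)) expnM.
  by rewrite -modnXm rho1 modnXm exp1n.
have rho1 : ((r ^ alpha)%N%:Z = 1 %[mod d%:Z])%Z.
  by apply/eqz_mod_nat; rewrite -modnXm rd modnXm exp1n.
by rewrite -R_rho_d -modzMmr rho1 modzMmr mulr1.
Qed.

(** By [R_eq1_mod] the common divisors of [M] and [R - 1] are those of [M] and
    [r - 1], and [r - 1] divides [M = (r - 1) s]. *)
Lemma quotient_gcd : ((1 * M%:Z) %/ gcdz M%:Z (R - 1))%Z = s%:Z.
Proof.
have ME : M = (s * r.-1)%N.
  by rewrite -(mul_n_q r_gt1 r1) /M -(mul_n_s r1) /s; ring.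
have r1_gt0 : (0 < r.-1)%N by rewrite -subn1 subn_gt0.
suff -> : gcdz M%:Z (R - 1) = r.-1%:Z by rewrite mul1r ME PoszM mulzK // -lt0n.
have dvd_iff (d : nat) : (d %| n * M)%N -> (d%:Z %| R - 1)%Z = (d %| r.-1)%N.
  move=> dN; rewrite -eqz_mod_dvd -subn1 -eqn_mod_dvd ?(ltnW r_gt1) //.
  by apply/eqP/eqP => /(R_eq1_mod dN).
congr Posz; apply/eqP; rewrite eqn_dvd -/(gcdz M (R - 1)); apply/andP; split.
  rewrite -dvd_iff; last by rewrite dvdn_mull // dvdn_gcdl.
  by rewrite dvdzE dvdn_gcdr.
rewrite dvdn_gcd {1}ME dvdn_mull //=.
by have := dvd_iff r.-1; rewrite dvdnn dvdzE => ->; rewrite // ME dvdn_mull // dvdn_mull.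
Qed.

End Gcd.

End Integers.

(** * Identification of the presented groups with the affine model *)

(** Normal forms are closed under the group operations, so it suffices to find
    them for the generators. *)
Lemma presented_normal (X : choiceType) (rels : seq (word X)) n M rho s
    (a b : presented rels) :
  0 < n -> 0 < M -> meta_rel n M rho s a b ->
  (forall x, meta_normal a b (pres_class rels [:: (x, false)])) ->
  forall g, meta_normal a b g.
Proof.
move=> n_gt0 M_gt0 rel_ab; apply: presented_ind.
- exact: meta_normal1.
- exact: meta_normalM rel_ab.
- exact: meta_normalV rel_ab n_gt0 M_gt0.
Qed.

Section Identification.
Variables (m r alpha : nat) (k : int).
Let n := m.+1.
Let kappa := `|((r%:Z + k - 1)%R %% n)%Z|%N.
Hypotheses (r_gt1 : 1 < r) (r1 : r = 1 %[mod n]).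
Hypothesis alphakappa : alpha * kappa = 1 %[mod n].
Let M := r.-1 %/ n * gsum r n.
Let rho := r ^ alpha.
Let s := gsum r n %/ n.
Let params : affine_params n M rho := affine_params_r alpha (ltn0Sn m) r_gt1 r1.
Let ns : n * s = gsum rho n %[mod n * M] := ns_rho (ltn0Sn m) r_gt1 r1 alphakappa.
Let M_pos : 0 < M. Proof. by case/and4P: params. Qed.
Local Open Scope group_scope.

Lemma F_group_model :
  metacyclic_group (F_group r n k) /\
  exists phi : UMagmaMorphism.type (F_group r n k) (affine_group params), bijective phi.
Proof.
pose gen x : F_group r n k :=
  pres_class (traject (@theta n) (F_relator m r k) n) [:: (x, false)].
pose y := cyc_fun gen.
have [y_per y_rel] : cyc_rel n r kappa y.
  by apply/F_relatorsP => w; exact: relator_eval.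
have rel_ab := cyc_rel_meta (ltn0Sn m) r_gt1 r1 alphakappa y_per y_rel.
have normal_ab g : meta_normal (window y 0 n) (y 0) g.
  apply: (presented_normal _ M_pos rel_ab) => // x.
  have -> : pres_class (traject (@theta n) (F_relator m r k) n) [:: (x, false)] = y x.
    by rewrite /y /cyc_fun modn_small // inord_val.
  rewrite (cyc_normal r_gt1 r1 alphakappa y_per y_rel x).
  by exists 1%N, (cyc_exponent n r alpha (alpha * x)).
split; first exact: (meta_metacyclic rel_ab).
have relK := affine_meta_rel params ns.
pose e := cyc_elt n r alpha (affine_elt params n) (affine_elt params 1).
have [e_per e_rel] : cyc_rel n r kappa e := cyc_elt_rel (ltn0Sn m) r_gt1 r1 alphakappa relK.
pose f (x : 'I_n) := e x.
have fE i : cyc_fun f i = e i.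
  by rewrite /cyc_fun /f inordK ?ltn_pmod //; apply: (periodic_mod e_per); rewrite modn_mod.
have f_rel : cyc_rel n r kappa (cyc_fun f).
  split=> i; first by rewrite !fE.
  by rewrite fE -e_rel; apply: eq_bigr => j _; rewrite fE.
have [phi phiE] := presented_lift (iffRL (F_relatorsP r k f) f_rel).
have phiy i : phi (y i) = e i by rewrite /y /cyc_fun phiE word_eval1 -fE.
exists phi; apply: (meta_model_bijective rel_ab) => //.
  rewrite gmulf_prod -[RHS](cyc_elt_window0 (ltn0Sn m) r_gt1 r1 alphakappa relK).
  by apply: eq_bigr => i _; rewrite phiy.
by rewrite phiy /e cyc_elt0.
Qed.

Lemma B_group_model (R : int) :
  ((R * rho)%R = 1%R %[mod M])%Z ->
  ((1 * M)%R %/ gcdz M (R - 1)%R)%Z = s ->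
  exists phi : UMagmaMorphism.type (B_group M n R 1) (affine_group params), bijective phi.
Proof.
move=> R_rho gcdE.
pose gen x : B_group M n R 1 := pres_class (B_relators M n R 1) [:: (x, false)].
have rel_ab : meta_rel n M rho s (gen ord0) (gen ord_max).
  by apply/(B_relatorsP n M_pos R_rho gcdE) => w; exact: relator_eval.
pose f (x : 'I_2) := affine_elt params (if x == ord0 then n else 1%N).
have f_rel : meta_rel n M rho s (f ord0) (f ord_max) by exact: affine_meta_rel.
have [phi phiE] := presented_lift (iffRL (B_relatorsP n M_pos R_rho gcdE f) f_rel).
exists phi; apply: (meta_model_bijective rel_ab).
- apply: (presented_normal _ M_pos rel_ab) => // x.
  have [->|x0] := eqVneq x ord0; first by exists 0%N, 1%N; rewrite mul1g.
  have -> : x = ord_max by apply: val_inj; case: x x0 => -[|[]].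
  by exists 1%N, 0%N; rewrite mulg1.
- by rewrite phiE word_eval1.
- by rewrite phiE word_eval1.
Qed.

End Identification.

Local Open Scope ring_scope.
Local Open Scope card_scope.

Theorem corollary10 (n r : nat) (k A R : int) :
  (0 < n)%N ->
  coprimez n%:Z k ->
  (1 < r)%N ->
  (r = 1 %[mod n])%N ->
  ((r%:Z + k - 1) * A = 1 %[mod n%:Z])%Z ->
  is_powmod (r%:Z ^+ n - 1) r%:Z ((n%:Z - 1) * A) R ->
  let M := ((r ^ n - 1) %/ n)%N in
  [/\ (R ^+ n = 1 %[mod M%:Z])%Z,
      group_iso (F_group r n k) (B_group M%:Z n%:Z R 1),
      metacyclic_group (F_group r n k)
    & [set: F_group r n k]%classic #= `I_(r ^ n - 1)%N].
Proof.
case: n => [//|m] n_gt0 _ r_gt1 r1 kA Rpow M; set n := m.+1 in n_gt0 r1 kA Rpow M *.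
pose alpha := `|(A %% n)%Z|%N.
have alphakappa : (alpha * `|((r%:Z + k - 1)%R %% n)%Z| = 1 %[mod n])%N.
  apply/eqz_mod_nat; rewrite PoszM -[LHS]modzMml (alpha_mod A n_gt0) modzMml.
  by rewrite gez0_abs ?modz_ge0 // modzMmr mulrC.
have nM := mul_n_M r_gt1 r1.
have NE : (r ^ n - 1 = n * (r.-1 %/ n * gsum r n))%N by rewrite -nM addnK.
have ME : M = (r.-1 %/ n * gsum r n)%N by rewrite /M NE mulKn.
have R_rho_N : (R * (r ^ alpha)%N%:Z = 1 %[mod (n * M)%N%:Z])%Z.
  rewrite ME -NE -subzn ?expn_gt0 ?(ltnW r_gt1) // (Posz_expn r n).
  exact: powmod_inverse n_gt0 (ltnW r_gt1) Rpow.
have R_rho : (R * (r ^ alpha)%N%:Z = 1 %[mod M%:Z])%Z.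
  move/eqP: R_rho_N; rewrite eqz_mod_dvd => h; apply/eqP; rewrite eqz_mod_dvd.
  by apply: dvdz_trans h; rewrite dvdzE dvdn_mull.
have params := affine_params_r alpha n_gt0 r_gt1 r1.
have [meta [phi bij_phi]] := F_group_model r_gt1 r1 alphakappa.
rewrite ME in R_rho_N R_rho *.
split=> //.
- have rho_n : (((r ^ alpha) ^ n)%N%:Z = 1 %[mod (r.-1 %/ n * gsum r n)%N%:Z])%Z.
    apply/eqz_mod_nat; case/and4P: params => _ _ _ /eqP e.
    by rewrite -(modn_dvdm _ (dvdn_mull n (dvdnn _))) e modn_dvdm // dvdn_mull.
  rewrite -[R ^+ n]mulr1 -modzMmr -{1}rho_n modzMmr (Posz_expn (r ^ alpha) n) -exprMn -modzXm.
  by rewrite R_rho modzXm expr1n.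
- have [psi bij_psi] := B_group_model r_gt1 r1 alphakappa R_rho
    (quotient_gcd r_gt1 r1 alphakappa R_rho_N).
  exact: group_iso_via bij_phi bij_psi.
- rewrite NE; exact: (card_bijective_ord bij_phi).
Qed.
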